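(* Let $K$ be a field, and let $g,h$ be coprime polynomials in $K[x]$ with $\max(\deg g,\deg h)=2$. Then the quadratic rational expression $g(x)/h(x)$, upon composing on both sides with affine maps $x\mapsto ax+b$ (with $a\in K^{\ast}$, $b\in K$) and the inversion map $x\mapsto 1/x$, repeatedly and in some order, can be brought to the form $x+\sigma x^{-1}$ for some $\sigma\in K^{\ast}$, or, when $\operatorname{char} K=2$, to the form $x^2$.
   Context: $K^{\ast}=K\setminus\{0\}$. A quadratic rational expression over $K$ is $R(x)=g(x)/h(x)\in K(x)$ with $g,h\in K[x]$ coprime and $\max(\deg g,\deg h)=2$. Composing $R(x)$ on both sides means that one may apply pre-composition $R(x)\mapsto R(m(x))$ and post-composition $R(x)\mapsto m(R(x))$, where $m$ is an affine map $x\mapsto ax+b$ ($a\in K^{\ast}$, $b\in K$) or the inversion map $x\mapsto 1/x$, finitely many times and in some order. *)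

(* Defs.v *)
From HB Require Import structures.
From mathcomp Require Import all_boot all_algebra.

Set Implicit Arguments.
Unset Strict Implicit.
Unset Printing Implicit Defensive.

Import GRing.Theory.
Local Open Scope ring_scope.

Notation "{ 'ratfun' K }" := {fraction {poly K}}
  (format "{ 'ratfun'  K }") : type_scope.

Notation "p %:F" := (@FracField.tofrac _ p) (format "p %:F") : ring_scope.

Definition ratC (K : fieldType) (c : K) : {ratfun K} := (c%:P)%:F.

Definition ratX (K : fieldType) : {ratfun K} := 'X%:F.

Definition poly_at (K : fieldType) (p : {poly K}) (S : {ratfun K})
  : {ratfun K} := (map_poly (@ratC K) p).[S].

(* R(S), computed on the representative of R chosen by [repr]. By
   [ratcomp_frac] the representative is irrelevant as soon as S is not a root
   of a nonzero polynomial over K; by [elementary_transcendental] this is the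
   case for all the S used below. *)
Definition ratcomp (K : fieldType) (R S : {ratfun K}) : {ratfun K} :=
  poly_at \n_(repr R) S / poly_at \d_(repr R) S.

(* The library's convention 0^-1 = 0 plays no role: expressions obtained from a
   nonconstant one by these maps are nonconstant. *)
Variant elementary (K : fieldType) : ({ratfun K} -> {ratfun K}) -> Prop :=
  | Affine (a b : K) of a != 0 : elementary (fun y => ratC a * y + ratC b)
  | Inversion : elementary (fun y => y^-1).

Inductive brought_to (K : fieldType) (R : {ratfun K}) : {ratfun K} -> Prop :=
  | Brought_refl : brought_to R R
  | Brought_pre S m of brought_to R S & elementary m :
      brought_to R (ratcomp S (m (ratX K)))
  | Brought_post S m of brought_to R S & elementary m :
      brought_to R (m S).

Section Composition.
Variable K : fieldType.
Implicit Types (p g h : {poly K}) (S : {ratfun K}).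

Definition transcendental S := forall p, p != 0 -> poly_at p S != 0.

Fact ratC_is_zmod_morphism : zmod_morphism (@ratC K).
Proof. by move=> a b; rewrite /ratC polyCB rmorphB. Qed.
Fact ratC_is_monoid_morphism : monoid_morphism (@ratC K).
Proof. by split=> [|a b]; rewrite /ratC ?polyCM ?rmorphM ?rmorph1. Qed.
HB.instance Definition _ := GRing.isZmodMorphism.Build K {ratfun K} (@ratC K)
  ratC_is_zmod_morphism.
HB.instance Definition _ := GRing.isMonoidMorphism.Build K {ratfun K} (@ratC K)
  ratC_is_monoid_morphism.

Lemma poly_atM p g S : poly_at (p * g) S = poly_at p S * poly_at g S.
Proof. by rewrite /poly_at rmorphM hornerM. Qed.

Lemma poly_atE p S : poly_at p S = \sum_(i < size p) ratC p`_i * S ^+ i.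
Proof.
rewrite /poly_at horner_coef size_map_poly.
by apply: eq_bigr => i _; rewrite coef_map.
Qed.

Lemma poly_at_tofrac p g : poly_at p g%:F = (p \Po g)%:F.
Proof.
rewrite poly_atE comp_polyE rmorph_sum; apply: eq_bigr => i _.
by rewrite -mul_polyC rmorphM rmorphXn.
Qed.

Lemma repr_frac (R : {ratfun K}) : R = (\n_(repr R))%:F / (\d_(repr R))%:F.
Proof.
have d0 : (\d_(repr R))%:F != 0 :> {ratfun K} by rewrite tofrac_eq0 denom_ratioP.
apply: (mulIf d0); rewrite divfK //.
rewrite -[X in X * _ = _](@reprK _ _ R).
unlock FracField.tofrac.
rewrite -[LHS]FracField.pi_mul.
apply/eqmodP; rewrite /= FracField.equivfE /FracField.mulf.
by rewrite !numden_Ratio ?mulr1 ?mul1r ?mulf_neq0 ?oner_neq0 ?denom_ratioP // mulrC.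
Qed.

Lemma ratcomp_frac g h S : h != 0 -> transcendental S ->
  ratcomp (g%:F / h%:F) S = poly_at g S / poly_at h S.
Proof.
move=> h0 trS; rewrite /ratcomp; set R := g%:F / h%:F.
have d0 : \d_(repr R) != 0 by exact: denom_ratioP.
have E : \n_(repr R) * h = g * \d_(repr R).
  apply/eqP; rewrite -tofrac_eq !tofracM -eqr_div ?tofrac_eq0 //.
  by rewrite -repr_frac.
by apply/eqP; rewrite eqr_div ?trS // -!poly_atM E.
Qed.

Lemma elementary_transcendental m :
  elementary m -> transcendental (m (ratX K)).
Proof.
case=> [a b a0|] p p0.
  rewrite /ratC /ratX -tofracM -tofracD poly_at_tofrac tofrac_eq0.
  by rewrite comp_poly_eq0 // size_MXaddC polyC_eq0 (negPf a0) size_polyC a0.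
pose q : {poly K} := \sum_(i < size p) p`_i *: 'X^(size p - i).
have x0 : ratX K != 0 by rewrite tofrac_eq0 polyX_eq0.
have Eq : q%:F = poly_at p (ratX K)^-1 * ratX K ^+ size p.
  rewrite poly_atE mulr_suml rmorph_sum; apply: eq_bigr => i _ /=.
  rewrite -mul_polyC tofracM tofracXn -mulrA exprVn; congr (_ * _).
  have Ei : size p = (i + (size p - i))%N by rewrite subnKC // ltnW.
  by rewrite [in ratX K ^+ _]Ei exprD mulKf ?expf_neq0.
suff q0 : q != 0.
  by apply: contraNneq q0 => E; rewrite -tofrac_eq0 Eq E mul0r.
have n0 : ((size p).-1 < size p)%N by rewrite ltn_predL size_poly_gt0.
apply: contraNneq p0 => /(congr1 (fun r : {poly K} => r`_1)).
rewrite coef0 coef_sum (bigD1 (Ordinal n0)) //= big1 => [|i ne_i].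
  rewrite coefZ coefXn addr0 -subn1 subKn ?mulr1 ?subn1 => [/eqP|].
    by rewrite -lead_coefE lead_coef_eq0.
  exact: leq_trans n0.
rewrite coefZ coefXn [1%N == _](_ : _ = false) ?mulr0 //.
apply: contraNF ne_i => /eqP E; apply/eqP/val_inj => /=.
by rewrite -subn1 E subKn // ltnW.
Qed.
End Composition.

(* Main.v *)
Require Import Defs.
From mathcomp Require Import all_boot all_algebra.
From mathcomp Require Import ring.
Set Implicit Arguments.
Unset Strict Implicit.
Unset Printing Implicit Defensive.
Import GRing.Theory.
Local Open Scope ring_scope.

(** Look at a quadratic expression as a degree 2 map of the projective line.
    Up to an affine post-composition, it has the form [x + sigma / x] exactly
    when its poles are 0 and infinity; so it is enough to find one rational
    value whose fibre consists of two distinct rational points, and to move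
    this value to infinity and these points to 0 and infinity.

    The value at infinity is moved to infinity by a post-composition, so that
    [deg g = 2] and [deg h <= 1] ([brought_to_small_denominator] does the case
    where this value is finite). If [deg h = 1], the other pole is the root of
    [h], and it is rational ([linear_denominator]). If [h] is constant,
    infinity is a double pole and an affine map gives [x^2 + b x]. For
    [b != 0] the fibre above 0 is [{0, -b}], and exchanging 0 and infinity on
    both sides gives a linear denominator ([split_quadratic]). What is left is
    [x^2]: outside characteristic 2 its fibre above 1 is [{1, -1}], which
    amounts to the translation [(x + 1)^2 - 1 = x^2 + 2 x]; in characteristic
    2 it is the exceptional form. *)

(** Here [f] stands for the embedding [ratC] of the constants; over abstract
    fields [field] is not lured into unfolding fractions of polynomials. *)
Section FieldIdentities.
Variables (F L : fieldType) (f : {rmorphism F -> L}).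
Implicit Types (a b c e l : F) (y z : L).

Lemma translated_quotient a b c e l y : a != 0 -> l != 0 -> y != 0 ->
  y + f ((a * e ^+ 2 + b * e + c) / a) * y^-1 =
  f (l / a) * ((f a * (y + f e) ^+ 2 + f b * (y + f e) + f c) /
               (f l * (y + f e) + f (- (l * e))))
    + f (- ((2 * a * e + b) / a)).
Proof.
move=> a0 l0 y0; have [fa0 fl0] : f a != 0 /\ f l != 0 by rewrite !fmorph_eq0.
have -> : f l * (y + f e) + f (- (l * e)) = f l * y by ring.
by field; rewrite ?a0 ?y0 ?fa0 ?fl0.
Qed.

Lemma monic_quotient a b c l y : a != 0 -> l != 0 ->
  y ^+ 2 + f (b / a) * y =
  f (l / a) * ((f a * y ^+ 2 + f b * y + f c) / f l) + f (- (c / a)).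
Proof.
move=> a0 l0; have [fa0 fl0] : f a != 0 /\ f l != 0 by rewrite !fmorph_eq0.
by field; rewrite ?fa0 ?fl0.
Qed.

Lemma inverted_quadratic b y : y != 0 ->
  (y^-1 ^+ 2 + f b * y^-1)^-1 = y ^+ 2 / (f b * y + 1).
Proof.
move=> y0; rewrite -[RHS]invf_div; congr _^-1.
by field.
Qed.

Lemma translated_square y :
  y ^+ 2 + f 2%:R * y = f 1 * (f 1 * y + f 1) ^+ 2 + f (- 1).
Proof. by ring. Qed.

Lemma inverted_difference c y z : z != 0 ->
  z / (y - f c * z) = (f 1 * (y / z) + f (- c))^-1.
Proof.
move=> z0; rewrite -[LHS]invf_div; congr _^-1.
by field.
Qed.

End FieldIdentities.

Section QuadraticNormalForm.
Variable K : fieldType.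
Implicit Types (p g h : {poly K}) (R S T : {ratfun K}).

Local Notation x := (ratX K).
Local Notation normal_form sigma := (x + ratC sigma * x^-1).

Lemma brought_to_trans R S T :
  brought_to R S -> brought_to S T -> brought_to R T.
Proof.
move=> RS; elim=> [|U m _ RU mE|U m _ RU mE] //; first exact: Brought_pre.
exact: Brought_post.
Qed.

Lemma brought_to_affine (a b : K) R :
  a != 0 -> brought_to R (ratC a * R + ratC b).
Proof. by move=> a0; apply: Brought_post (Brought_refl R) (Affine b a0). Qed.

Lemma brought_to_inv R : brought_to R R^-1.
Proof. exact: Brought_post (Brought_refl R) (Inversion K). Qed.

Lemma brought_to_precomp g h m : h != 0 -> elementary m ->
  brought_to (g%:F / h%:F) (poly_at g (m x) / poly_at h (m x)).
Proof.
move=> h0 mE; rewrite -(ratcomp_frac g h0 (elementary_transcendental mE)).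
exact: Brought_pre (Brought_refl _) mE.
Qed.

Lemma poly_at_quadratic p S : (size p <= 3)%N ->
  poly_at p S = ratC p`_2 * S ^+ 2 + ratC p`_1 * S + ratC p`_0.
Proof.
move=> p3; rewrite /poly_at (@horner_coef_wide _ 3) ?size_map_poly //.
by rewrite !big_ord_recl big_ord0 /= !coef_map /=; ring.
Qed.

Lemma poly_at_ratX p : poly_at p x = p%:F.
Proof. by rewrite poly_at_tofrac comp_polyXr. Qed.

Lemma ratX_neq0 : x != 0.
Proof. by rewrite tofrac_eq0 polyX_eq0. Qed.

Lemma lead_coef_neq0 p n : size p = n.+1 -> p`_n != 0.
Proof.
by move=> pn; rewrite -[n]/n.+1.-1 -pn -lead_coefE lead_coef_eq0
  -size_poly_eq0 pn.
Qed.

(** Translating the root of [h] to 0 leaves [a x + b + c / x]; [a] is nonzero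
    by the degree of [g], and [c], a multiple of the value of [g] at the root
    of [h], by coprimality. *)
Lemma linear_denominator g h :
  coprimep g h -> size g = 3%N -> size h = 2%N ->
  exists2 sigma, sigma != 0 & brought_to (g%:F / h%:F) (normal_form sigma).
Proof.
move=> cop_gh g3 h2; have x0 := ratX_neq0.
have [a0 l0] := (lead_coef_neq0 g3, lead_coef_neq0 h2).
have h20 : h`_2 = 0 by rewrite nth_default ?h2.
have [e hE] : exists e, h`_0 = - (h`_1 * e).
  by exists (- (h`_0 / h`_1)); field.
have he : root h e.
  rewrite rootE horner_coef h2 !big_ord_recl big_ord0 /= hE.
  by apply/eqP; ring.
have ge : g.[e] != 0.
  by apply: coprimep_root he; rewrite coprimep_sym.
have geE : g.[e] = g`_2 * e ^+ 2 + g`_1 * e + g`_0.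
  by rewrite horner_coef g3 !big_ord_recl big_ord0 /=; ring.
exists (g.[e] / g`_2); first by rewrite mulf_neq0 ?invr_eq0.
have h0 : h != 0 by rewrite -size_poly_eq0 h2.
apply: brought_to_trans (brought_to_precomp g h0 (Affine e (oner_neq0 K))) _.
rewrite !poly_at_quadratic ?g3 ?h2 // h20 hE geE.
rewrite rmorph0 mul0r add0r rmorph1 mul1r.
rewrite (translated_quotient (@ratC K) g`_1 g`_0 e a0 l0 x0).
by apply: brought_to_affine; rewrite mulf_neq0 ?invr_eq0.
Qed.

(** Inverting on both sides exchanges the fibres above 0 and infinity and
    turns [x (x + b)] into [x^2 / (b x + 1)]. *)
Lemma split_quadratic (b : K) : b != 0 ->
  exists2 sigma, sigma != 0 &
    brought_to (x ^+ 2 + ratC b * x) (normal_form sigma).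
Proof.
move=> b0; have x0 := ratX_neq0.
pose h : {poly K} := b *: 'X + 1.
have h2 : size h = 2%N.
  by rewrite /h -mul_polyC size_MXaddC polyC_eq0 (negPf b0) size_polyC b0.
have cop : coprimep 'X^2 h.
  by rewrite coprimep_expl // coprimep_sym coprimepX /h rootE !hornerE oner_eq0.
have [sigma s0 Hs] := linear_denominator cop (size_polyXn _ _) h2.
exists sigma => //; apply: brought_to_trans Hs.
pose q : {poly K} := 'X^2 + b *: 'X.
have qE : q%:F = x ^+ 2 + ratC b * x.
  by rewrite /q -mul_polyC tofracD tofracXn tofracM.
have q3 : size q = 3%N.
  rewrite /q size_polyDl size_polyXn //.
  by apply: leq_ltn_trans (size_scale_leq _ _) _; rewrite size_polyX.
have q0 : q != 0 by rewrite -size_poly_eq0 q3.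
rewrite -qE; apply: brought_to_trans (brought_to_inv _) _.
have := brought_to_precomp 1 q0 (Inversion K).
rewrite tofrac1 div1r.
congr (brought_to _ _).
rewrite !poly_at_quadratic ?q3 ?size_poly1 //.
rewrite /q /h !coefE /= -mul_polyC tofracD tofracXn tofracM tofrac1.
rewrite -/(ratC b) -/(ratX K) !(mulr1, mulr0, addr0, add0r, rmorph0, rmorph1).
by rewrite !(mul0r, add0r) div1r mul1r (inverted_quadratic (@ratC K) b x0).
Qed.

Lemma constant_denominator g h : size g = 3%N -> size h = 1%N ->
  (exists2 sigma, sigma != 0 &
     brought_to (g%:F / h%:F) (normal_form sigma))
  \/ (2%N \in [pchar K] /\ brought_to (g%:F / h%:F) (x ^+ 2)).
Proof.
move=> g3 h1; have [a0 l0] := (lead_coef_neq0 g3, lead_coef_neq0 h1).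
have s0 : h`_0 / g`_2 != 0 by rewrite mulf_neq0 ?invr_eq0.
pose b := g`_1 / g`_2.
have to_monic : brought_to (g%:F / h%:F) (x ^+ 2 + ratC b * x).
  rewrite /b (monic_quotient (@ratC K) g`_1 g`_0 x a0 l0).
  rewrite -poly_at_quadratic ?g3 // poly_at_ratX.
  rewrite [in X in brought_to X](size1_polyC (eq_leq h1)).
  exact: brought_to_affine.
have [b0|b0] := eqVneq b 0; last first.
  left; have [sigma s0' Hs] := split_quadratic b0.
  by exists sigma => //; apply: brought_to_trans Hs.
rewrite b0 rmorph0 mul0r addr0 in to_monic.
(* Only [x^2] is left; outside characteristic 2, its translate
   [(x + 1)^2 - 1 = x (x + 2)] has two simple zeros. *)
have [K2|K2] := boolP (2%N \in [pchar K]); first by right.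
left; have two0 : 2%:R != 0 :> K by apply: contra K2; rewrite inE.
have [sigma s0' Hs] := split_quadratic two0.
exists sigma => //; apply: brought_to_trans Hs.
apply: brought_to_trans to_monic _.
have := brought_to_precomp 'X^2 (oner_neq0 _) (Affine 1 (oner_neq0 K)).
rewrite tofrac1 divr1 tofracXn -/(ratX K) => /brought_to_trans; apply.
rewrite (translated_square (@ratC K)).
have -> : poly_at 'X^2 (ratC 1 * x + ratC 1) / poly_at 1 (ratC 1 * x + ratC 1)
    = (ratC 1 * x + ratC 1) ^+ 2.
  by rewrite /poly_at map_polyXn !rmorph1 hornerXn (hornerC 1) divr1.
exact: brought_to_affine (oner_neq0 K).
Qed.

(** When the value at infinity is finite, it is the quotient [c] of the
    coefficients of degree 2, and [y |-> 1 / (y - c)] sends it to infinity. *)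
Lemma brought_to_small_denominator g h :
  coprimep g h -> maxn (size g).-1 (size h).-1 = 2%N ->
  exists g' h', [/\ coprimep g' h', size g' = 3%N, (size h' < 3)%N
                  & brought_to (g%:F / h%:F) (g'%:F / h'%:F)].
Proof.
move=> cop deg.
have [g3 h3] : (size g <= 3)%N /\ (size h <= 3)%N.
  have : (maxn (size g).-1 (size h).-1 <= 2)%N by rewrite deg.
  by rewrite geq_max; case: (size g) (size h) => [|m] [|n] /andP[].
have [hlt|hge] := ltnP (size h) 3.
  exists g, h; split=> //; last exact: Brought_refl.
  apply/eqP; rewrite eqn_leq g3 ltnNge; apply/negP=> g2.
  have pred_lt2 n : (n < 3)%N -> (n.-1 < 2)%N by case: n.
  have : (maxn (size g).-1 (size h).-1 < 2)%N by rewrite gtn_max !pred_lt2.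
  by rewrite deg.
have {hge} h3E : size h = 3%N by apply/eqP; rewrite eqn_leq h3.
have l0 := lead_coef_neq0 h3E.
pose c := g`_2 / h`_2.
exists h, (g - c *: h); split=> //.
- by rewrite -mul_polyC addrC -mulNr coprimep_addl_mul coprimep_sym.
- apply/leq_sizeP=> j; rewrite leq_eqVlt => /predU1P[<-|j3].
    by rewrite coefB coefZ /c divfK // subrr.
  by rewrite coefB coefZ !nth_default ?mulr0 ?subr0 // ?h3E // (leq_trans g3).
have := brought_to_affine (- c) (g%:F / h%:F) (oner_neq0 K).
move=> /brought_to_trans; apply.
have -> : h%:F / (g - c *: h)%:F = (ratC 1 * (g%:F / h%:F) + ratC (- c))^-1.
  have hF : h%:F != 0 :> {ratfun K} by rewrite tofrac_eq0 -size_poly_eq0 h3E.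
  by rewrite -mul_polyC tofracB tofracM (inverted_difference (@ratC K)).
exact: brought_to_inv.
Qed.

End QuadraticNormalForm.

Theorem theorem2 (K : fieldType) (g h : {poly K})
    (cop_gh : coprimep g h)
    (deg_gh : maxn (size g).-1 (size h).-1 = 2%N) :
  (exists2 sigma : K, sigma != 0 &
     brought_to (g%:F / h%:F) (ratX K + ratC sigma * (ratX K)^-1))
  \/ (2%N \in [pchar K] /\ brought_to (g%:F / h%:F) (ratX K ^+ 2)).
Proof.
have [g' [h' [cop g3 h3 gh]]] := brought_to_small_denominator cop_gh deg_gh.
have h0 : h' != 0.
  by apply: contraTneq cop => ->; rewrite coprimep0 -size_poly_eq1 g3.
case h'E: (size h') h3 => [|[|[|n]]] // _.
- by move: h0; rewrite -size_poly_eq0 h'E.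
- have [[s s0 Hs]|[K2 H2]] := constant_denominator g3 h'E.
    by left; exists s => //; apply: brought_to_trans Hs.
  by right; split=> //; apply: brought_to_trans H2.
have [s s0 Hs] := linear_denominator cop g3 h'E.
by left; exists s => //; apply: brought_to_trans Hs.
Qed.
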